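(* The bipartite prefix-stable information distance $D$ exceeds $E_1(x,y)=\max(\mathrm{KP}(x\mid y),\mathrm{KP}(y\mid x))$ by an unbounded amount: there is no constant $c$ such that $D(x,y)\le E_1(x,y)+c$ for all binary strings $x,y$.
   Context: A computable partial function $U(p,x)$ (binary strings to binary strings) is prefix-stable if whenever $U(p,x)$ is defined, $U(p',x)$ is defined and equal to $U(p,x)$ for every extension $p'$ of $p$. For a pair $(U,U')$ of such functions let $E_{U,U'}(x,y)=\min\{|p| : U(p,x)=y \text{ and } U'(p,y)=x\}$. There is a pair of prefix-stable computable partial functions making $E_{U,U'}$ minimal up to an additive constant among all such pairs; this minimal function is the bipartite prefix-stable information distance $D$. $\mathrm{KP}(y\mid x)$ denotes conditional prefix complexity: $\min\{|p|:V(p,x)=y\}$ for an optimal prefix-free computable partial $V$ (prefix-free: for each $x$, the domain in $p$ contains no string together with a proper prefix of it). *)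

(* Defs.v *)
From mathcomp Require Import all_boot.
Set Implicit Arguments.
Unset Strict Implicit.
Unset Printing Implicit Defensive.

Inductive prog : Type :=
| PZero
| PSucc
| PProj (i : nat)
| PComp (f : prog) (gs : list prog)
| PRec (f g : prog)
| PMu (f : prog).

Inductive eval : prog -> seq nat -> nat -> Prop :=
| ev_zero v : eval PZero v 0
| ev_succ v : eval PSucc v (head 0 v).+1
| ev_proj i v : eval (PProj i) v (nth 0 v i)
| ev_comp f gs v w y : evals gs v w -> eval f w y -> eval (PComp f gs) v y
| ev_rec0 f g v y : eval f v y -> eval (PRec f g) (0 :: v) y
| ev_recS f g n v r y :
    eval (PRec f g) (n :: v) r -> eval g [:: n, r & v] y ->
    eval (PRec f g) (n.+1 :: v) y
| ev_mu f v n :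
    eval f (n :: v) 0 ->
    (forall m, m < n -> exists k, 0 < k /\ eval f (m :: v) k) ->
    eval (PMu f) v n
with evals : list prog -> seq nat -> seq nat -> Prop :=
| evs_nil v : evals nil v [::]
| evs_cons g gs v y ys : eval g v y -> evals gs v ys -> evals (g :: gs) v (y :: ys).

(* Binary strings are [seq bool]; bijective encoding into nat. *)
Definition bstr := seq bool.
Fixpoint code (s : bstr) : nat :=
  match s with
  | [::] => 0
  | b :: s' => (code s').*2 + 1 + b
  end.

Definition pfun2 := bstr -> bstr -> option bstr.

Definition computable2 (U : pfun2) : Prop :=
  exists e : prog, forall p x y,
    U p x = Some y <-> eval e [:: code p; code x] (code y).

Definition prefix_stable (U : pfun2) : Prop :=
  forall p x y, U p x = Some y -> forall q, U (p ++ q) x = Some y.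

Definition prefix_free (V : pfun2) : Prop :=
  forall x p q, q != [::] -> V p x <> None -> V (p ++ q) x <> None -> False.

(* [E_le U U' x y n]  <->  E_{U,U'}(x,y) <= n, i.e.
   min{|p| : U(p,x) = y and U'(p,y) = x} <= n  (min of empty set = +oo). *)
Definition E_le (U U' : pfun2) (x y : bstr) (n : nat) : Prop :=
  exists p : bstr, size p <= n /\ U p x = Some y /\ U' p y = Some x.

(* [K_le V y x n]  <->  K_V(y | x) = min{|p| : V(p,x) = y} <= n. *)
Definition K_le (V : pfun2) (y x : bstr) (n : nat) : Prop :=
  exists p : bstr, size p <= n /\ V p x = Some y.

(* (U,U') is an optimal pair: E_{U,U'} is minimal up to an additive constant
   among all pairs of prefix-stable computable partial functions; then
   E_{U,U'} is the bipartite prefix-stable information distance D. *)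
Definition optimal_pair (U U' : pfun2) : Prop :=
  [/\ computable2 U, prefix_stable U, computable2 U', prefix_stable U' &
    forall W W' : pfun2,
      computable2 W -> prefix_stable W -> computable2 W' -> prefix_stable W' ->
      exists c : nat, forall x y n, E_le W W' x y n -> E_le U U' x y (n + c)].

Definition optimal_prefix_free (V : pfun2) : Prop :=
  [/\ computable2 V, prefix_free V &
    forall W : pfun2, computable2 W -> prefix_free W ->
      exists c : nat, forall y x n, K_le W y x n -> K_le V y x (n + c)].

Definition E1_le (V : pfun2) (x y : bstr) (n : nat) : Prop :=
  K_le V x y n /\ K_le V y x n.

(* Main.v *)
Require Import Defs.
From mathcomp Require Import all_boot zify.
From Stdlib Require Import ClassicalEpsilon.
Set Implicit Arguments.
Unset Strict Implicit.
Unset Printing Implicit Defensive.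

(** Idea.  A game is played against the pair (U, U').  A left vertex x carries a status:
    a number R of remaining rounds, a constant c, and the history of the answers
    received so far.  The left vertices in one status are grouped in blocks of 2^R, and
    all the vertices x of a block are connected to one fresh right vertex y.  The edge
    is cheap in both directions: given y, the R-bit rank of x in the block names x;
    given x, the unary code of R names y.  If D <= E_1 + O(1), then U and U' have to
    provide a common program p of length R + c for the edge, and x moves on to the
    status (R - 1, c, p :: history).

    Let S_m be the set of prefixes of length m of a history.  The 2^R answers in a
    block are distinct and, by prefix stability, avoid S_{R+c}.  Hence, as long as
    |S_j| 2^(R+c-j) < 2^R + |S_{R+c}|, some answer of every block has a new prefix of
    length j.  By the pigeonhole principle there is then a next status that infinitely
    many vertices reach and in which S_j has grown.  Playing 2^(T+c) rounds with target
    level j = T + c raises the density of S_j to 2^-c more than the density of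
    the initial S at the finer level; after 2^c such phases no string is left for the
    next answer.

    All the games (c, N) are played simultaneously by one computable procedure, since
    c depends on the constant that optimality of V provides for this procedure. *)

(** * Computable functions on vectors of fixed length *)

(** The length is fixed because a composition passes its arguments on through a fixed list of
    programs: even the identity has to be spelled out as [k] projections. *)
Definition vcomp k (f : seq nat -> nat) :=
  exists e, forall v, size v = k -> eval e v (f v).

Definition vcomps k (F : seq nat -> seq nat) :=
  exists es, forall v, size v = k -> evals es v (F v).

Fixpoint prec (b : nat) (st : nat -> nat -> nat) (n : nat) : nat :=
  if n is m.+1 then st m (prec b st m) else b.

Lemma vcomp_ext k f g :
  (forall v, size v = k -> f v = g v) -> vcomp k f -> vcomp k g.
Proof. by move=> fg [e He]; exists e => v sv; rewrite -fg //; exact: He. Qed.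

Lemma vcomps_ext k F G :
  (forall v, size v = k -> F v = G v) -> vcomps k F -> vcomps k G.
Proof. by move=> fg [e He]; exists e => v sv; rewrite -fg //; exact: He. Qed.

Lemma evals_nth es v l i : evals es v l -> eval (nth PZero es i) v (nth 0 l i).
Proof.
elim: es l i => [|e es IH] l i H; inversion H; subst.
  by rewrite !nth_nil; constructor.
by case: i => [|i] //=; apply: IH.
Qed.

Lemma evals_drop es v l j : evals es v l -> evals (drop j es) v (drop j l).
Proof.
elim: es l j => [|e es IH] l j H; inversion H; subst => //.
by case: j => [|j] //=; apply: IH.
Qed.

Lemma vcomps_nil k : vcomps k (fun=> [::]).
Proof. by exists [::] => v _; constructor. Qed.

Lemma vcomps_cons k g G : vcomp k g -> vcomps k G -> vcomps k (fun v => g v :: G v).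
Proof.
by move=> [e He] [es Hes]; exists (e :: es) => v sv; constructor; auto.
Qed.

Lemma vcomps_id k : vcomps k (fun v => v).
Proof.
apply: (@vcomps_ext _ (fun v => [seq nth 0 v i | i <- iota 0 k])).
  by move=> v <-; exact: mkseq_nth.
elim: (iota 0 k) => [|i s IH]; first exact: vcomps_nil.
by apply: (@vcomps_cons _ (nth 0 ^~ i)) IH; exists (PProj i) => v _; constructor.
Qed.

Lemma vcomps_drop k j F : vcomps k F -> vcomps k (fun v => drop j (F v)).
Proof. by move=> [es H]; exists (drop j es) => v sv; apply/evals_drop/H. Qed.

Lemma vcomp_nth k i F : vcomps k F -> vcomp k (fun v => nth 0 (F v) i).
Proof. by move=> [es H]; exists (nth PZero es i) => v sv; apply/evals_nth/H. Qed.

Lemma vcomp_comp k j f F :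
  vcomp j f -> vcomps k F -> (forall v, size v = k -> size (F v) = j) ->
  vcomp k (fun v => f (F v)).
Proof.
move=> [e He] [es Hes] sF; exists (PComp e es) => v sv.
by apply: ev_comp (Hes _ sv) _; apply/He/sF.
Qed.

Lemma vcomp_prec k b st n :
  vcomp k b -> vcomp k n ->
  vcomp k.+2 (fun w => st (nth 0 w 0) (nth 0 w 1) (drop 2 w)) ->
  vcomp k (fun v => prec (b v) (fun i r => st i r v) (n v)).
Proof.
move=> [eb Hb] [en Hn] [es Hs]; have [ei Hi] := vcomps_id k.
exists (PComp (PRec eb es) (en :: ei)) => v sv.
apply: ev_comp; first by apply: evs_cons; [exact: Hn | exact: Hi].
elim: (n v) => [|m IH]; first by apply: ev_rec0; exact: Hb.
apply: ev_recS IH _.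
have := Hs [:: m, prec (b v) (fun i r => st i r v) m & v]; rewrite /= drop0.
by apply; rewrite sv.
Qed.

Lemma vcomp_shift n k f : vcomp k f -> vcomp (n + k) (fun w => f (drop n w)).
Proof.
move=> Hf; apply: (vcomp_comp Hf); first exact/vcomps_drop/vcomps_id.
by move=> v sv; rewrite size_drop sv addKn.
Qed.

Lemma vcomps_shift n k F : vcomps k F -> vcomps (n + k) (fun w => F (drop n w)).
Proof.
have [ei Hi] := vcomps_drop n (vcomps_id (n + k)); move=> [es Hes].
exists [seq PComp e ei | e <- es] => v sv.
have sd : size (drop n v) = k by rewrite size_drop sv addKn.
have := Hes _ sd; move: (F _) => l; elim: es l {Hes} => [|e es IH] l Hl;
  inversion Hl; subst; first by constructor.
by apply: evs_cons; [apply: ev_comp (Hi _ sv) _ | apply: IH].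
Qed.

Lemma vcomp_S k a : vcomp k a -> vcomp k (fun v => (a v).+1).
Proof.
move=> [e He]; exists (PComp PSucc [:: e]) => v sv; apply: (@ev_comp _ _ _ [:: a v]).
  by repeat constructor; apply: He.
exact: (ev_succ [:: a v]).
Qed.

Lemma vcomp_const k n : vcomp k (fun=> n).
Proof.
elim: n => [|n IH]; last exact: vcomp_S.
by exists PZero => v _; constructor.
Qed.

Ltac vcomp_leaf := first [ by apply: vcomp_const
  | by (apply: vcomp_nth; repeat apply: vcomps_drop; apply: vcomps_id) ].

Lemma vcomp_add k a b : vcomp k a -> vcomp k b -> vcomp k (fun v => a v + b v).
Proof.
move=> Ha Hb; apply: (@vcomp_ext _ (fun v => prec (a v) (fun _ r => r.+1) (b v))).
  by move=> v _; elim: (b v) => [|n /= ->]; rewrite ?addn0 ?addnS.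
by apply: (@vcomp_prec k a (fun _ r _ => r.+1)) => //; apply: vcomp_S; vcomp_leaf.
Qed.

Lemma vcomp_pred k a : vcomp k a -> vcomp k (fun v => (a v).-1).
Proof.
move=> Ha; apply: (@vcomp_ext _ (fun v => prec 0 (fun i _ => i) (a v))).
  by move=> v _; case: (a v).
by apply: (@vcomp_prec k (fun=> 0) (fun i _ _ => i)) => //; vcomp_leaf.
Qed.

Lemma vcomp_sub k a b : vcomp k a -> vcomp k b -> vcomp k (fun v => a v - b v).
Proof.
move=> Ha Hb; apply: (@vcomp_ext _ (fun v => prec (a v) (fun _ r => r.-1) (b v))).
  by move=> v _; elim: (b v) => [|n /= ->]; rewrite ?subn0 ?subnS.
by apply: (@vcomp_prec k a (fun _ r _ => r.-1)) => //; apply: vcomp_pred; vcomp_leaf.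
Qed.

Lemma vcomp_mul k a b : vcomp k a -> vcomp k b -> vcomp k (fun v => a v * b v).
Proof.
move=> Ha Hb; apply: (@vcomp_ext _ (fun v => prec 0 (fun _ r => r + a v) (b v))).
  by move=> v _; elim: (b v) => [|n /= ->]; rewrite ?muln0 // mulnS addnC.
apply: (@vcomp_prec k (fun=> 0) (fun _ r v => r + a v)) => //; first by vcomp_leaf.
by apply: vcomp_add; [vcomp_leaf | exact: (@vcomp_shift 2)].
Qed.

Lemma vcomp_exp2 k a : vcomp k a -> vcomp k (fun v => 2 ^ a v).
Proof.
move=> Ha; apply: (@vcomp_ext _ (fun v => prec 1 (fun _ r => r + r) (a v))).
  by move=> v _; elim: (a v) => [|n /= ->] //; rewrite expnS mul2n addnn.
apply: (@vcomp_prec k (fun=> 1) (fun _ r _ => r + r)) => //; first by vcomp_leaf.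
by apply: vcomp_add; vcomp_leaf.
Qed.

Lemma vcomp_leq k a b : vcomp k a -> vcomp k b -> vcomp k (fun v => a v <= b v : bool).
Proof.
move=> Ha Hb; apply: (@vcomp_ext _ (fun v => 1 - (a v - b v))); first by move=> v _; lia.
by apply: vcomp_sub; [vcomp_leaf | apply: vcomp_sub].
Qed.

Lemma vcomp_and k (a b : seq nat -> bool) :
  vcomp k a -> vcomp k b -> vcomp k (fun v => a v && b v : bool).
Proof.
move=> Ha Hb; apply: (@vcomp_ext _ (fun v => a v * b v)); first by move=> v _; rewrite mulnb.
exact: vcomp_mul.
Qed.

Lemma vcomp_not k (a : seq nat -> bool) : vcomp k a -> vcomp k (fun v => ~~ a v : bool).
Proof.
move=> Ha; apply: (@vcomp_ext _ (fun v => 1 - a v)); first by move=> v _; case: (a v).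
by apply: vcomp_sub => //; vcomp_leaf.
Qed.

Lemma vcomp_or k (a b : seq nat -> bool) :
  vcomp k a -> vcomp k b -> vcomp k (fun v => a v || b v : bool).
Proof.
move=> Ha Hb; apply: (@vcomp_ext _ (fun v => ~~ (~~ a v && ~~ b v) : bool)).
  by move=> v _; case: (a v); case: (b v).
by apply: vcomp_not; apply: vcomp_and; apply: vcomp_not.
Qed.

Lemma vcomp_eq k a b : vcomp k a -> vcomp k b -> vcomp k (fun v => a v == b v : bool).
Proof.
move=> Ha Hb; apply: (@vcomp_ext _ (fun v => (a v <= b v) && (b v <= a v))).
  by move=> v _; rewrite eqn_leq.
by apply: vcomp_and; apply: vcomp_leq.
Qed.

Lemma vcomp_if k (c : seq nat -> bool) a b :
  vcomp k c -> vcomp k a -> vcomp k b -> vcomp k (fun v => if c v then a v else b v).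
Proof.
move=> Hc Ha Hb; apply: (@vcomp_ext _ (fun v => c v * a v + (~~ c v) * b v)).
  by move=> v _; case: (c v); lia.
by apply: vcomp_add; apply: vcomp_mul => //; exact: vcomp_not.
Qed.

Lemma vcomp_sum k n (F : nat -> seq nat -> nat) :
  vcomp k n -> vcomp k.+1 (fun w => F (nth 0 w 0) (drop 1 w)) ->
  vcomp k (fun v => \sum_(i < n v) F i v).
Proof.
move=> Hn HF; apply: (@vcomp_ext _ (fun v => prec 0 (fun i r => r + F i v) (n v))).
  move=> v _; elim: (n v) => [|m /= ->]; first by rewrite big_ord0.
  by rewrite big_ord_recr.
apply: (@vcomp_prec k (fun=> 0) (fun i r v => r + F i v)) => //; first by vcomp_leaf.
apply: vcomp_add; first by vcomp_leaf.
apply: (@vcomp_ext _ ((fun w => F (nth 0 w 0) (drop 1 w)) \o (fun w => nth 0 w 0 :: drop 2 w))).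
  by move=> v _ /=; rewrite drop0.
apply: (vcomp_comp HF); first by apply: vcomps_cons; [vcomp_leaf | exact/vcomps_drop/vcomps_id].
by move=> v sv /=; rewrite size_drop sv; lia.
Qed.

(** Bounded search is done by counting: quotients and integer square roots are numbers of indices
    that satisfy a downward closed condition. *)
Lemma count_lt (m n : nat) (P : pred nat) :
  (forall i, P i = (i < m)) -> m <= n -> \sum_(i < n) P i = m.
Proof.
move=> HP mn; under eq_bigr => i _ do rewrite HP.
elim: n mn => [|n IH] mn; first by rewrite big_ord0; lia.
rewrite big_ord_recr /=; case: (ltnP n m) => h; last by rewrite IH //; lia.
have -> : m = n.+1 by lia.
rewrite (eq_bigr (fun=> 1)); first by rewrite sum1_card card_ord; lia.
by move=> i _; have := ltn_ord i; lia.
Qed.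

Lemma vcomp_divexp2 k a b : vcomp k a -> vcomp k b -> vcomp k (fun v => a v %/ 2 ^ b v).
Proof.
move=> Ha Hb; apply: (@vcomp_ext _ (fun v => \sum_(i < a v) (i.+1 * 2 ^ b v <= a v))).
  move=> v _; apply: (@count_lt _ _ (fun i => i.+1 * 2 ^ b v <= a v)); last exact: leq_div.
  by move=> i; rewrite leq_divRL ?expn_gt0.
apply: (@vcomp_sum k a (fun i v => i.+1 * 2 ^ b v <= a v : bool)) => //.
apply: vcomp_leq; last exact: (@vcomp_shift 1).
by apply: vcomp_mul; [apply: vcomp_S; vcomp_leaf | apply: vcomp_exp2; exact: (@vcomp_shift 1)].
Qed.

Lemma vcomp_modexp2 k a b : vcomp k a -> vcomp k b -> vcomp k (fun v => a v %% 2 ^ b v).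
Proof.
move=> Ha Hb; apply: (@vcomp_ext _ (fun v => a v - a v %/ 2 ^ b v * 2 ^ b v)).
  by move=> v _; rewrite {1}(divn_eq (a v) (2 ^ b v)) addKn.
by apply: vcomp_sub => //; apply: vcomp_mul; [exact: vcomp_divexp2 | exact: vcomp_exp2].
Qed.

(** * A pairing function *)

Definition pair a b := (a + b) ^ 2 + a.
Definition isqrt n := \sum_(i < n) (i.+1 * i.+1 <= n).
Definition p1 n := n - isqrt n * isqrt n.
Definition p2 n := isqrt n - p1 n.

(** [pair a b] is at least the square of [a + b] and below the next square. *)
Lemma isqrt_pair a b : isqrt (pair a b) = a + b.
Proof.
apply: (@count_lt _ _ (fun i => i.+1 * i.+1 <= pair a b)); last by rewrite /pair; nia.
by move=> i; rewrite /pair; apply/idP/idP; nia.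
Qed.

Lemma pairK1 a b : p1 (pair a b) = a.
Proof. by rewrite /p1 isqrt_pair /pair -mulnn addKn. Qed.

Lemma pairK2 a b : p2 (pair a b) = b.
Proof. by rewrite /p2 isqrt_pair pairK1 addKn. Qed.

Definition pairE := (pairK1, pairK2).

Lemma p1_leq n : p1 n <= n. Proof. exact: leq_subr. Qed.

Lemma leq_pair2 a b : b <= pair a b. Proof. rewrite /pair; nia. Qed.

Lemma vcomp_pair k a b : vcomp k a -> vcomp k b -> vcomp k (fun v => pair (a v) (b v)).
Proof.
move=> Ha Hb; rewrite /pair; apply: vcomp_add => //.
by have H := vcomp_add Ha Hb; apply: vcomp_mul.
Qed.

Lemma vcomp_isqrt k a : vcomp k a -> vcomp k (fun v => isqrt (a v)).
Proof.
move=> Ha; rewrite /isqrt.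
apply: (@vcomp_sum k a (fun i v => i.+1 * i.+1 <= a v : bool)) => //.
apply: vcomp_leq; first by apply: vcomp_mul; apply: vcomp_S; vcomp_leaf.
exact: (@vcomp_shift 1).
Qed.

Lemma vcomp_p1 k a : vcomp k a -> vcomp k (fun v => p1 (a v)).
Proof.
by move=> Ha; have H := vcomp_isqrt Ha; apply: vcomp_sub => //; apply: vcomp_mul.
Qed.

Lemma vcomp_p2 k a : vcomp k a -> vcomp k (fun v => p2 (a v)).
Proof.
by move=> Ha; apply: vcomp_sub; [exact: vcomp_isqrt | exact: vcomp_p1].
Qed.

(** * Evaluation with fuel *)

(* 0 means that the fuel [s], which bounds the unbounded searches, did not suffice;
   [y.+1] means that the result is [y]. *)
Fixpoint run (e : prog) (s : nat) (v : seq nat) {struct e} : nat :=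
  match e with
  | PZero => 1
  | PSucc => (head 0 v).+2
  | PProj i => (nth 0 v i).+1
  | PComp f gs =>
      let ws := [seq run g s v | g <- gs] in
      if 0 \in ws then 0 else run f s (map predn ws)
  | PRec f g =>
      if v is _ :: _ then
        prec (run f s (drop 1 v))
          (fun i r => if r == 0 then 0 else run g s [:: i, r.-1 & drop 1 v]) (nth 0 v 0)
      else 0
  | PMu f =>
      let n := prec 0 (fun i r => if (r == i) && (1 < run f s (i :: v)) then i.+1 else r) s in
      if run f s (n :: v) == 1 then n.+1 else 0
  end.

(* The automatically generated induction principle ignores the list in [PComp]. *)
Fixpoint all_sub (P : prog -> Prop) (gs : seq prog) : Prop :=
  if gs is g :: gs' then P g /\ all_sub P gs' else True.

Lemma prog_nested_ind (P : prog -> Prop) :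
  P PZero -> P PSucc -> (forall i, P (PProj i)) ->
  (forall f gs, P f -> all_sub P gs -> P (PComp f gs)) ->
  (forall f g, P f -> P g -> P (PRec f g)) ->
  (forall f, P f -> P (PMu f)) -> forall e, P e.
Proof.
move=> H0 HS Hp Hc Hr Hm; fix IH 1; case.
- exact: H0.
- exact: HS.
- exact: Hp.
- move=> f gs; apply: Hc; first exact: IH.
  by elim: gs => [//|g gs IHgs]; split; [exact: IH | exact: IHgs].
- by move=> f g; apply: Hr; exact: IH.
- by move=> f; apply: Hm; exact: IH.
Qed.

(** The program is fixed, so induction on it shows that bounded evaluation is computable in the fuel
    and the arguments; no universal program is built. *)
Lemma vcomp_run e : forall k j a F, vcomp k a -> vcomps k F ->
  (forall v, size v = k -> size (F v) = j) -> vcomp k (fun v => run e (a v) (F v)).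
Proof.
elim/prog_nested_ind: e => [||i|f gs IHf IHgs|f g IHf IHg|f IHf] k j a F Ha HF sF /=.
- exact: vcomp_const.
- apply: (@vcomp_ext _ (fun v => (nth 0 (F v) 0).+2)); first by move=> v; rewrite nth0.
  by do 2!apply: vcomp_S; apply: vcomp_nth.
- by apply: vcomp_S; apply: vcomp_nth.
- have Hws : vcomps k (fun v => [seq run g (a v) (F v) | g <- gs]) /\
             vcomp k (fun v => 0 \in [seq run g (a v) (F v) | g <- gs] : bool).
    elim: gs IHgs => [_|g gs IH /= [Hg /IH [H1 H2]]]; first by
      split; [exact: vcomps_nil | exact: vcomp_const].
    have Hr := Hg k j a F Ha HF sF.
    split; first exact: vcomps_cons.
    apply: (@vcomp_ext _ (fun v => if run g (a v) (F v) == 0 then 1 else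
               0 \in [seq run g (a v) (F v) | g <- gs] : bool)).
      by move=> v _; rewrite in_cons [0 == _]eq_sym; case: eqP.
    by apply: vcomp_if; [apply: vcomp_eq => //; exact: vcomp_const | exact: vcomp_const |].
  apply: vcomp_if; [exact: Hws.2 | exact: vcomp_const |].
  apply: (IHf k (size gs)) => //; last by move=> v _; rewrite !size_map.
  elim: gs IHgs {Hws} => [_|g gs IH /= [Hg /IH H1]]; first exact: vcomps_nil.
  by apply: vcomps_cons => //; apply: vcomp_pred; exact: (Hg k j).
- case: j sF => [|j] sF.
    apply: (@vcomp_ext _ (fun=> 0)); last exact: vcomp_const.
    by move=> v /sF /size0nil ->.
  apply: (@vcomp_ext _ (fun v => prec (run f (a v) (drop 1 (F v)))
      (fun i r => if r == 0 then 0 else run g (a v) [:: i, r.-1 & drop 1 (F v)])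
      (nth 0 (F v) 0))).
    by move=> v /sF; case: (F v).
  have sd (v : seq nat) : size v = k.+2 -> size (drop 2 v) = k.
    by move=> sv; rewrite size_drop sv subn2.
  apply: (@vcomp_prec k (fun v => run f (a v) (drop 1 (F v)))
     (fun i r v => if r == 0 then 0 else run g (a v) [:: i, r.-1 & drop 1 (F v)])
     (fun v => nth 0 (F v) 0)).
  + apply: (IHf k j) => //; first exact: vcomps_drop.
    by move=> v sv; rewrite size_drop sF // subn1.
  + exact: vcomp_nth.
  + apply: vcomp_if; [by apply: vcomp_eq; vcomp_leaf | exact: vcomp_const |].
    apply: (IHg _ j.+2); first exact: (@vcomp_shift 2).
      apply: vcomps_cons; first by vcomp_leaf.
      apply: vcomps_cons; first by apply: vcomp_pred; vcomp_leaf.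
      exact/vcomps_drop/(@vcomps_shift 2).
    by move=> v sv; rewrite /= size_drop sF ?subn1 // sd.
- have sd (v : seq nat) : size v = k.+2 -> size (drop 2 v) = k.
    by move=> sv; rewrite size_drop sv subn2.
  pose st i r v := if (r == i) && (1 < run f (a v) (i :: F v)) then i.+1 else r.
  have Hn : vcomp k (fun v => prec 0 (fun i r => st i r v) (a v)).
    apply: (@vcomp_prec k (fun=> 0) st) => //; first exact: vcomp_const.
    apply: vcomp_if; [apply: vcomp_and | by apply: vcomp_S; vcomp_leaf | by vcomp_leaf];
      first by apply: vcomp_eq; vcomp_leaf.
    apply: vcomp_leq; first exact: vcomp_const.
    apply: (IHf _ j.+1); first exact: (@vcomp_shift 2).
      by apply: vcomps_cons; [vcomp_leaf | exact: (@vcomps_shift 2)].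
    by move=> v sv; rewrite /= sF // sd.
  apply: vcomp_if; [apply: vcomp_eq; last exact: vcomp_const | exact: vcomp_S | exact: vcomp_const].
  apply: (IHf _ j.+1) => //; first by apply: vcomps_cons.
  by move=> v sv /=; rewrite sF.
Qed.

(** Working with all large fuels lets finitely many evaluations share one fuel without a
    monotonicity lemma for [run]. *)
Definition eventually (P : nat -> Prop) := exists s0, forall s, s0 <= s -> P s.

Lemma eventually_and P Q :
  eventually P -> eventually Q -> eventually (fun s => P s /\ Q s).
Proof.
move=> [a Ha] [b Hb]; exists (maxn a b) => s; rewrite geq_max => /andP[sa sb].
by split; [exact: Ha | exact: Hb].
Qed.

Lemma eventually_imp (P Q : nat -> Prop) :
  (forall s, P s -> Q s) -> eventually P -> eventually Q.
Proof. by move=> PQ [a Ha]; exists a => s /Ha /PQ. Qed.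

Lemma eventually_all n (P : nat -> nat -> Prop) :
  (forall m, m < n -> eventually (P m)) ->
  eventually (fun s => forall m, m < n -> P m s).
Proof.
elim: n => [|n IH] H; first by exists 0.
have H1 := IH (fun m mn => H m (ltnW mn)).
apply: eventually_imp (eventually_and H1 (H n (ltnSn n))) => s [Ha Hb] m.
by rewrite ltnS leq_eqVlt => /orP[/eqP ->|/Ha].
Qed.

Lemma eventually_geq n (P : nat -> Prop) : eventually P -> exists2 s, n <= s & P s.
Proof.
by move=> [s0 H]; exists (maxn n s0); [exact: leq_maxl | apply: H; exact: leq_maxr].
Qed.

(** The loop of [run] for [PMu], with the number of iterations separated from the fuel for
    induction. The candidate freezes at the first argument where [f] is not seen to be positive. *)
Definition mu_iter f s v n :=
  prec 0 (fun i r => if (r == i) && (1 < run f s (i :: v)) then i.+1 else r) n.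

Lemma mu_iterP f s v n : mu_iter f s v n <= n /\
  forall m, m < mu_iter f s v n -> 1 < run f s (m :: v).
Proof.
rewrite /mu_iter; elim: n => [|n [IH1 IH2]] //=.
case: eqP => [E|_] /=; last by split; [exact: leqW | ].
case: ifP => h; last by split; [exact: leqW | ].
split=> // m; rewrite ltnS leq_eqVlt => /orP[/eqP -> //|mn].
by apply: IH2; rewrite E.
Qed.

Lemma mu_iter_stop f s v n k :
  (forall m, m < n -> 1 < run f s (m :: v)) -> run f s (n :: v) = 1 ->
  n <= k -> mu_iter f s v k = n.
Proof.
move=> Hlt Hn.
have Hle m : m <= n -> mu_iter f s v m = m.
  by elim: m => [//|m IH] mn; rewrite /mu_iter /= -/(mu_iter _ _ _ _) IH ?eqxx ?Hlt // ltnW.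
elim: k => [|k IH]; first by rewrite leqn0 => /eqP ->.
rewrite leq_eqVlt => /orP[/eqP <-|nk]; first exact: Hle.
rewrite /mu_iter /= -/(mu_iter _ _ _ _) IH //.
by case: eqP => [<-|] //; rewrite Hn.
Qed.

Lemma run_sound e : forall s v y, run e s v = y.+1 -> eval e v y.
Proof.
elim/prog_nested_ind: e => [||i|f gs IHf IHgs|f g IHf IHg|f IHf] s v y /=.
- by case=> <-; constructor.
- by case=> <-; constructor.
- by case=> <-; constructor.
- case: ifP => // h0 /IHf; apply: ev_comp.
  elim: gs IHgs h0 => [|g gs IH] /=; first by constructor.
  move=> [Hg Hgs]; rewrite in_cons => /norP[h0 h1].
  constructor; last by apply: IH => //; exact/negbTE.
  by apply: (Hg s); rewrite prednK // lt0n eq_sym.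
- case: v => [//|n v] /=; rewrite drop0.
  elim: n y => [|n IH] y /=; first by move/IHf; constructor.
  case: eqP => // /eqP h0 /IHg; apply: ev_recS; apply: IH.
  by rewrite prednK // lt0n.
- rewrite -/(mu_iter f s v s); case: eqP => // h1 [<-].
  constructor; first exact: IHf h1.
  move=> m /(proj2 (mu_iterP f s v s)) h; exists (run f s (m :: v)).-1.
  by split; [lia | apply: (IHf s); lia].
Qed.

Lemma run_complete e : forall v y, eval e v y -> eventually (fun s => run e s v = y.+1).
Proof.
elim/prog_nested_ind: e => [||i|f gs IHf IHgs|f g IHf IHg|f IHf] v y H.
- by exists 0 => s _; inversion H.
- by exists 0 => s _; inversion H.
- by exists 0 => s _; inversion H.
- inversion H as [| | |f' gs' v' w y' Hw Hf| | |]; subst.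
  have Hgs : eventually (fun s => [seq run g s v | g <- gs] = [seq n.+1 | n <- w]).
    elim: gs w IHgs Hw {H Hf} => [|g gs IH] w /= IHgs Hw.
      by inversion Hw; exists 0.
    inversion Hw as [|g' gs' v' y0 w' Hg0 Hw']; subst.
    have [Hg Hgs] := IHgs.
    apply: eventually_imp (eventually_and (Hg _ _ Hg0) (IH _ Hgs Hw')).
    by move=> s [-> ->].
  apply: eventually_imp (eventually_and Hgs (IHf _ _ Hf)) => s [/= -> Hs].
  have -> : (0 \in [seq n.+1 | n <- w]) = false by apply/negP => /mapP[].
  by rewrite -map_comp map_id_in.
- have [n [v' E]] : exists n v', v = n :: v' by inversion H; subst; eauto.
  subst v; rewrite /= drop0; elim: n y H => [|n IH] y H.
    by inversion H; subst; exact: IHf.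
  inversion H as [| | | | |f' g' n' v'' r y' Hr Hg|]; subst.
  apply: eventually_imp (eventually_and (IH _ Hr) (IHg _ _ Hg)) => s [h1 h2] /=.
  by rewrite h1.
- inversion H as [| | | | | |f' v' n H0 Hlt]; subst.
  have H1 : eventually (fun s => forall m, m < y -> 1 < run f s (m :: v)).
    apply: eventually_all => m /Hlt[k [k0 /IHf]].
    by apply: eventually_imp => s ->.
  have H2 : eventually (fun s => y <= s) by exists y.
  apply: eventually_imp (eventually_and H2 (eventually_and H1 (IHf _ _ H0))).
  move=> s [sy [Ha Hb]] /=; rewrite -/(mu_iter f s v s) (mu_iter_stop Ha Hb sy).
  by rewrite Hb.
Qed.

(** [run] is a function and agrees with both derivations for large fuel. *)
Lemma eval_fun e v y z : eval e v y -> eval e v z -> y = z.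
Proof.
move=> /run_complete Hy /run_complete Hz.
by have [s _ [-> []]] := eventually_geq 0 (eventually_and Hy Hz).
Qed.

(** [PMu] applied to [1 - B] finds the first stage at which [B] is nonzero; the output is the
    predecessor of that value. *)
Lemma search_prog (B : seq nat -> nat) : vcomp 3 B ->
  exists e, forall a b y, eval e [:: a; b] y <->
    exists2 t, B [:: t; a; b] = y.+1 & forall m, m < t -> B [:: m; a; b] = 0.
Proof.
move=> HB.
have [ez Hz] : vcomp 3 (fun v => 1 - B v) by apply: vcomp_sub => //; apply: vcomp_const.
have [eo Ho] : vcomp 3 (fun v => (B v).-1) by apply: vcomp_pred.
exists (PComp eo [:: PMu ez; PProj 0; PProj 1]) => a b y; split=> [H|[t Bt Blt]].
  inversion H as [| | |f gs v w y' Hw Hf| | |]; subst.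
  inversion Hw as [|? ? ? t ? Ht Hw1]; subst.
  inversion Hw1 as [|? ? ? a' ? Ha Hw2]; subst; inversion Ha; subst.
  inversion Hw2 as [|? ? ? b' ? Hb Hw3]; subst; inversion Hb; subst.
  inversion Hw3; subst; clear Hw Hw1 Hw2 Hw3 Ha Hb.
  inversion Ht as [| | | | | |? ? ? H0 Hlt]; subst.
  have E0 := eval_fun H0 (Hz [:: t; a; b] (erefl _)).
  have E1 := eval_fun Hf (Ho [:: t; a; b] (erefl _)).
  exists t; first by simpl in E1; lia.
  move=> m /Hlt[k [k0 Hk]].
  by have := eval_fun Hk (Hz [:: m; a; b] (erefl _)); lia.
apply: (@ev_comp _ _ _ [:: t; a; b]); last first.
  by have := Ho [:: t; a; b] (erefl _); rewrite Bt.
constructor; last by repeat constructor.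
constructor; first by have := Hz [:: t; a; b] (erefl _); rewrite Bt.
move=> m /Blt mt; exists 1; split=> //.
by have := Hz [:: m; a; b] (erefl _); rewrite mt.
Qed.

(** * The event log of the game *)

Lemma code_inj : injective code.
Proof.
elim=> [|a s IH] [|b t] //=; try by case: a || case: b; lia.
move=> E; have [-> Ec] : a = b /\ code s = code t.
  by case: a b E => [] [] E; split=> //; lia.
by rewrite (IH _ Ec).
Qed.

Lemma code_surj n : exists s, code s = n.
Proof.
have [m] := ubnP n; elim: m n => // m IH [|n] nm; first by exists [::].
have [|s Hs] := IH n./2; first by lia.
by exists (odd n :: s); rewrite /= Hs; have := odd_double_half n; lia.
Qed.

Definition decode n := proj1_sig (constructive_indefinite_description _ (code_surj n)).

Lemma decodeK n : code (decode n) = n.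
Proof. exact: proj2_sig (constructive_indefinite_description _ (code_surj n)). Qed.

Lemma codeK s : decode (code s) = s.
Proof. by apply: code_inj; rewrite decodeK. Qed.

(** In binary, lowest digit first, [(code s).+1] is [s] followed by the digit 1. *)
Lemma code_size s : 2 ^ size s <= (code s).+1 < 2 ^ (size s).+1.
Proof.
elim: s => // b s /=; rewrite ![2 ^ _.+1]expnS.
by set P := 2 ^ size s; case: b; lia.
Qed.

Lemma size_code s n : (size s == n) = (2 ^ n <= (code s).+1 < 2 ^ n.+1).
Proof.
have /andP[h1 h2] := code_size s.
apply/eqP/idP => [<-|/andP[h3 h4]]; first by rewrite h1 h2.
have := leq_ltn_trans h1 h4; have := leq_ltn_trans h3 h2.
by rewrite !ltn_exp2l //; lia.
Qed.

Definition unary R : bstr := rcons (nseq R false) true.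

Lemma code_unary R : code (unary R) = 3 * 2 ^ R - 1.
Proof.
elim: R => //= R ->; rewrite expnS; have := expn_gt0 2 R; lia.
Qed.

Lemma size_unary R : size (unary R) = R.+1.
Proof. by rewrite size_rcons size_nseq. Qed.

Lemma unary_prefix R R' q : unary R' = unary R ++ q -> q = [::].
Proof.
elim: R R' => [|R IH] [|R'] //=; last by case=> /IH.
by case=> <-.
Qed.

(** * The procedure that plays all the games *)

Section Machine.
Variables (eU eU' : prog).

(* An event records that the left vertex [x] enters the status [h] as the vertex of
   rank [q] (counted from 0).  Events are nonzero: 0 means that nothing happens. *)
Definition mkev x h q := (pair x (pair h q)).+1.
Definition ev_x e := p1 e.-1.
Definition ev_st e := p1 (p2 e.-1).
Definition ev_q e := p2 (p2 e.-1).

(* [R] remaining rounds in the game for the constant [c], history [l]. *)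
Definition mkst R c l := pair R (pair c l).
Definition st_R h := p1 h.
Definition st_c h := p1 (p2 h).
Definition st_l h := p2 (p2 h).

(* Left vertices have even codes, right vertices (a status and a block number) odd codes. *)
Definition lnode x := 2 * x.
Definition rnode h q := (2 * pair h (q %/ 2 ^ st_R h)).+1.

(* The bounds on [r.+1] say that [r] is the code of a string of length [m]. *)
Definition resp e s r :=
  let m := st_R (ev_st e) + st_c (ev_st e) in
  let x := lnode (ev_x e) in
  let y := rnode (ev_st e) (ev_q e) in
  [&& 2 ^ m <= r.+1, r.+2 <= 2 ^ m.+1, run eU s [:: r; x] == y.+1
    & run eU' s [:: r; y] == x.+1].

Definition next_st e r :=
  mkst (st_R (ev_st e)).-1 (st_c (ev_st e)) (pair r (st_l (ev_st e))).+1.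

(* A left vertex chooses its game: [x] codes the constant, the number of rounds, and
   an index that makes the supply infinite. *)
Definition root_st x := mkst (p1 (p2 x)) (p1 x) 0.

(* The stage number [t] codes a vertex [x], a candidate answer and an amount of fuel. *)
Definition new_st t e := if e == 0 then root_st (p1 t) else next_st e (p1 (p2 t)).

Definition fires t e :=
  (e == 0) || (0 < st_R (ev_st e)) && resp e (p2 (p2 t)) (p1 (p2 t)).

(* The log [L] at stage [t] lists the events of the stages below [t], the latest first. *)
Definition get L t i := p1 (prec L (fun _ r => p2 r) (t - i.+1)).

(** The loop starts at the oldest event, so the match that survives is the latest one. *)
Definition cur_in L t x :=
  prec 0 (fun i r => if (get L t i != 0) && (ev_x (get L t i) == x) then get L t i else r) t.

Definition count_in L t h :=
  \sum_(i < t) ((get L t i != 0) && (ev_st (get L t i) == h)).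

Definition step t L :=
  let e := cur_in L t (p1 t) in
  if fires t e then mkev (p1 t) (new_st t e) (count_in L t (new_st t e)) else 0.

(** Course-of-values recursion: the value carries all earlier events, since [step] consults the
    whole log. *)
Definition log := prec 0 (fun t L => pair (step t L) L).

Definition event t := step t (log t).

(* [3 * 2 ^ R - 1] is the code of the unary string 0^R 1, and [2 ^ R - 1 + i] for
   [i < 2 ^ R] is the code of the [i]-th string of length [R]. *)
Definition lookup t p z :=
  let e := event t in
  let x := ev_x e in let h := ev_st e in let q := ev_q e in
  if e == 0 then 0 else
  if (z == lnode x) && (p == 3 * 2 ^ st_R h - 1) then (rnode h q).+1 else
  if (z == rnode h q) && (p == 2 ^ st_R h - 1 + q %% 2 ^ st_R h) then (lnode x).+1
  else 0.

(** * Computability of the procedure *)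

Ltac vcomp_auto := repeat first [ assumption | lazymatch goal with
  | |- vcomp _ (fun v => nth 0 _ _) => vcomp_leaf
  | |- vcomp _ (fun _ => pair _ _) => apply: vcomp_pair
  | |- vcomp _ (fun _ => p1 _) => apply: vcomp_p1
  | |- vcomp _ (fun _ => p2 _) => apply: vcomp_p2
  | |- vcomp _ (fun _ => (_ %/ 2 ^ _)) => apply: vcomp_divexp2
  | |- vcomp _ (fun _ => (_ %% 2 ^ _)) => apply: vcomp_modexp2
  | |- vcomp _ (fun _ => 2 ^ _) => apply: vcomp_exp2
  | |- vcomp _ (fun _ => _ * _) => apply: vcomp_mul
  | |- vcomp _ (fun _ => _ - _) => apply: vcomp_sub
  | |- vcomp _ (fun _ => _ + _) => apply: vcomp_add
  | |- vcomp _ (fun _ => _.-1) => apply: vcomp_pred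
  | |- vcomp _ (fun _ => if _ then _ else _) => apply: vcomp_if
  | |- vcomp _ (fun _ => nat_of_bool (_ && _)) => apply: vcomp_and
  | |- vcomp _ (fun _ => nat_of_bool (_ || _)) => apply: vcomp_or
  | |- vcomp _ (fun _ => nat_of_bool (~~ _)) => apply: vcomp_not
  | |- vcomp _ (fun _ => nat_of_bool (_ == _)) => apply: vcomp_eq
  | |- vcomp _ (fun _ => nat_of_bool (_ <= _)) => apply: vcomp_leq
  | |- vcomp _ (fun _ => S _) => first [by apply: vcomp_const | apply: vcomp_S]
  | |- vcomp _ (fun=> _) => apply: vcomp_const
  end ].

Section Computability.
Variable k : nat.
Implicit Types a b L t : seq nat -> nat.

Lemma vcomp_mkev a b L : vcomp k a -> vcomp k b -> vcomp k L ->
  vcomp k (fun v => mkev (a v) (b v) (L v)).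
Proof. by move=> *; rewrite /mkev; vcomp_auto. Qed.
Lemma vcomp_ev_x a : vcomp k a -> vcomp k (fun v => ev_x (a v)).
Proof. by move=> *; rewrite /ev_x; vcomp_auto. Qed.
Lemma vcomp_ev_st a : vcomp k a -> vcomp k (fun v => ev_st (a v)).
Proof. by move=> *; rewrite /ev_st; vcomp_auto. Qed.
Lemma vcomp_ev_q a : vcomp k a -> vcomp k (fun v => ev_q (a v)).
Proof. by move=> *; rewrite /ev_q; vcomp_auto. Qed.
Lemma vcomp_st_R a : vcomp k a -> vcomp k (fun v => st_R (a v)).
Proof. by move=> *; rewrite /st_R; vcomp_auto. Qed.
Lemma vcomp_st_c a : vcomp k a -> vcomp k (fun v => st_c (a v)).
Proof. by move=> *; rewrite /st_c; vcomp_auto. Qed.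
Lemma vcomp_st_l a : vcomp k a -> vcomp k (fun v => st_l (a v)).
Proof. by move=> *; rewrite /st_l; vcomp_auto. Qed.
Lemma vcomp_lnode a : vcomp k a -> vcomp k (fun v => lnode (a v)).
Proof. by move=> *; rewrite /lnode; vcomp_auto. Qed.
Lemma vcomp_rnode a b : vcomp k a -> vcomp k b -> vcomp k (fun v => rnode (a v) (b v)).
Proof. by move=> *; rewrite /rnode; vcomp_auto; apply: vcomp_st_R. Qed.

Lemma vcomp_run2 e a b t : vcomp k a -> vcomp k b -> vcomp k t ->
  vcomp k (fun v => run e (t v) [:: a v; b v]).
Proof.
move=> Ha Hb Ht; apply: (@vcomp_run e k 2) => //.
by apply: vcomps_cons => //; apply: vcomps_cons => //; exact: vcomps_nil.
Qed.

Lemma vcomp_resp a b L : vcomp k a -> vcomp k b -> vcomp k L ->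
  vcomp k (fun v => resp (a v) (b v) (L v)).
Proof.
move=> Ha Hb HL; have Hs := vcomp_ev_st Ha; have HR := vcomp_st_R Hs; have Hc := vcomp_st_c Hs.
have Hx := vcomp_lnode (vcomp_ev_x Ha); have Hy := vcomp_rnode Hs (vcomp_ev_q Ha).
by rewrite /resp; vcomp_auto; apply: vcomp_run2; vcomp_auto.
Qed.

Lemma vcomp_new_st a b : vcomp k a -> vcomp k b -> vcomp k (fun v => new_st (a v) (b v)).
Proof.
move=> Ha Hb; have Hs := vcomp_ev_st Hb; have HR := vcomp_st_R Hs; have Hc := vcomp_st_c Hs.
have Hl := vcomp_st_l Hs.
by rewrite /new_st /root_st /next_st /mkst; vcomp_auto.
Qed.

Lemma vcomp_fires a b : vcomp k a -> vcomp k b -> vcomp k (fun v => fires (a v) (b v)).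
Proof.
move=> Ha Hb; have Hs := vcomp_ev_st Hb; have HR := vcomp_st_R Hs.
by rewrite /fires; vcomp_auto; apply: vcomp_resp; vcomp_auto.
Qed.

Lemma vcomp_get a b L : vcomp k L -> vcomp k a -> vcomp k b ->
  vcomp k (fun v => get (L v) (a v) (b v)).
Proof.
move=> HL Ha Hb; rewrite /get; vcomp_auto.
by apply: (@vcomp_prec k _ (fun _ r _ => p2 r)); vcomp_auto.
Qed.

End Computability.

Lemma vcomp_cur_in k a b L : vcomp k L -> vcomp k a -> vcomp k b ->
  vcomp k (fun v => cur_in (L v) (a v) (b v)).
Proof.
move=> HL Ha Hb; rewrite /cur_in.
apply: (@vcomp_prec k _ (fun i r v => if (get (L v) (a v) i != 0) &&
  (ev_x (get (L v) (a v) i) == b v) then get (L v) (a v) i else r)); vcomp_auto;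
  try apply: vcomp_ev_x; try apply: vcomp_get; vcomp_auto; exact: (@vcomp_shift 2).
Qed.

Lemma vcomp_count_in k a b L : vcomp k L -> vcomp k a -> vcomp k b ->
  vcomp k (fun v => count_in (L v) (a v) (b v)).
Proof.
move=> HL Ha Hb; rewrite /count_in.
apply: (@vcomp_sum k _ (fun i v => (get (L v) (a v) i != 0) &&
  (ev_st (get (L v) (a v) i) == b v) : nat)); vcomp_auto;
  try apply: vcomp_ev_st; try apply: vcomp_get; vcomp_auto; exact: (@vcomp_shift 1).
Qed.

Lemma vcomp_step k a L : vcomp k a -> vcomp k L -> vcomp k (fun v => step (a v) (L v)).
Proof.
move=> Ha HL; have Hc := vcomp_cur_in HL Ha (vcomp_p1 Ha).
have Hn := vcomp_new_st Ha Hc; have Hf := vcomp_fires Ha Hc.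
by rewrite /step; vcomp_auto; apply: vcomp_mkev; vcomp_auto; apply: vcomp_count_in.
Qed.

Lemma vcomp_ev k a : vcomp k a -> vcomp k (fun v => event (a v)).
Proof.
move=> Ha; rewrite /event; apply: vcomp_step => //; rewrite /log.
apply: (@vcomp_prec k _ (fun t L _ => pair (step t L) L)); vcomp_auto.
by apply: vcomp_step; vcomp_auto.
Qed.

Lemma vcomp_lookup : vcomp 3 (fun v => lookup (nth 0 v 0) (nth 0 v 1) (nth 0 v 2)).
Proof.
have H0 : vcomp 3 (nth 0 ^~ 0) by vcomp_leaf.
have He := vcomp_ev H0.
have Hx := vcomp_lnode (vcomp_ev_x He); have Hs := vcomp_ev_st He; have HR := vcomp_st_R Hs.
have Hq := vcomp_ev_q He; have Hr := vcomp_rnode Hs Hq.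
by rewrite /lookup; vcomp_auto.
Qed.
End Machine.

(** * Which events occur *)

Section Events.
Variables (eU eU' : prog).
Local Notation event := (event eU eU').
Local Notation log := (log eU eU').

Lemma log_drop t j : j <= t -> prec (log t) (fun _ r => p2 r) j = log (t - j).
Proof.
elim: j => [|j IH] jt /=; first by rewrite subn0.
by rewrite IH 1?ltnW // -(subnSK jt) /log /= pairK2.
Qed.

Lemma get_log t i : i < t -> get (log t) t i = event i.
Proof.
move=> it; rewrite /get log_drop ?leq_subr // subKn //=.
by rewrite /log /= pairK1.
Qed.

Definition is_ev_of x e := (e != 0) && (ev_x e == x).

Definition cur t x := prec 0 (fun i r => if is_ev_of x (event i) then event i else r) t.

Definition num_enters t h := \sum_(i < t) ((event i != 0) && (ev_st (event i) == h)).

(** From here on the sequence [event] replaces the coded log. *)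
Lemma evE t : event t =
  let e := cur t (p1 t) in
  if fires eU eU' t e then mkev (p1 t) (new_st t e) (num_enters t (new_st t e)) else 0.
Proof.
rewrite {1}/event /step.
have -> : cur_in (log t) t (p1 t) = cur t (p1 t).
  rewrite /cur_in /cur; set f := fun i r => _; set g := fun i r => _.
  suff H n : n <= t -> prec 0 f n = prec 0 g n by exact: H.
  by elim: n => //= n IH nt; rewrite IH 1?ltnW // /f get_log.
have -> h : count_in (log t) t h = num_enters t h.
  by apply: eq_bigr => i _; rewrite get_log.
by [].
Qed.

Definition enters t x h q := event t = mkev x h q.

Lemma mkevK x h q : (ev_x (mkev x h q) = x) * (ev_st (mkev x h q) = h) * (ev_q (mkev x h q) = q).
Proof. by rewrite /ev_x /ev_st /ev_q /mkev /= !pairE. Qed.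

Lemma mkstK R c l : (st_R (mkst R c l) = R) * (st_c (mkst R c l) = c) * (st_l (mkst R c l) = l).
Proof. by rewrite /st_R /st_c /st_l /mkst !pairE. Qed.

Lemma ev_ent t : event t != 0 -> enters t (p1 t) (ev_st (event t)) (num_enters t (ev_st (event t))).
Proof. by rewrite /enters evE /=; case: ifP => // _ _; rewrite mkevK. Qed.

Lemma enters_neq0 t x h q : enters t x h q -> event t != 0.
Proof. by move=> ->. Qed.

Lemma enters_num t x h q : enters t x h q -> (x = p1 t) * (q = num_enters t h).
Proof.
move=> E; have := ev_ent (enters_neq0 E); rewrite /enters E => F.
have := congr1 ev_x F; have := congr1 ev_q F.
by rewrite !mkevK => -> ->.
Qed.

Lemma num_enters_S t h :
  num_enters t.+1 h = num_enters t h + ((event t != 0) && (ev_st (event t) == h)).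
Proof. by rewrite /num_enters big_ord_recr. Qed.

Lemma num_enters_mono h : {homo num_enters ^~ h : s t / s <= t}.
Proof. by apply: homo_leq => // [a b c /leq_trans|t]; [exact | rewrite num_enters_S leq_addr]. Qed.

Lemma enters_lt t1 t2 x1 x2 h q1 q2 :
  enters t1 x1 h q1 -> enters t2 x2 h q2 -> t1 < t2 -> q1 < q2.
Proof.
move=> E1 E2 /(num_enters_mono h); rewrite num_enters_S E1 mkevK eqxx.
by rewrite (enters_num E1).2 (enters_num E2).2 addn1.
Qed.

Lemma enters_inj t1 t2 x1 x2 h q : enters t1 x1 h q -> enters t2 x2 h q -> t1 = t2 /\ x1 = x2.
Proof.
move=> E1 E2; have E : t1 = t2.
  case: (ltngtP t1 t2) => // H.
    by have := enters_lt E1 E2 H; rewrite ltnn.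
  by have := enters_lt E2 E1 H; rewrite ltnn.
by split=> //; rewrite (enters_num E1).1 (enters_num E2).1 E.
Qed.

Lemma num_enters_leq t h : num_enters t h <= t.
Proof.
rewrite -[X in _ <= X]muln1 -[X in X * _]card_ord -sum_nat_const.
by apply: leq_sum => i _; case: (_ && _).
Qed.

Definition infinite_st h := forall B, exists t x q, B <= t /\ enters t x h q.

(** Ranks in a status are consecutive: the entry that lifts the count above [q] has rank [q]. *)
Lemma infinite_st_all h : infinite_st h -> forall q, exists t x, enters t x h q.
Proof.
move=> Hinf q; have unb n : exists t, n <= num_enters t h.
  elim: n => [|n [t nt]]; first by exists 0.
  have [t' [x [q' [tt' E]]]] := Hinf t; exists t'.+1.
  rewrite num_enters_S E mkevK eqxx addn1 ltnS (leq_trans nt) //; exact: num_enters_mono.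
case: (ex_minnP (unb q.+1)) => -[|t] qt min_t; first by rewrite /num_enters big_ord0 in qt.
have lt_q : num_enters t h <= q by rewrite leqNgt; apply/negP => /min_t; rewrite ltnn.
move: qt; rewrite num_enters_S; case: andP => [[e0 /eqP eh]|_] /=; last by lia.
move=> qt; exists t, (p1 t); have := ev_ent e0; rewrite eh.
by have -> : num_enters t h = q by lia.
Qed.

Lemma curS t x : cur t.+1 x = if is_ev_of x (event t) then event t else cur t x.
Proof. by []. Qed.

Lemma cur_of t x : cur t x != 0 ->
  exists2 t', t' < t & is_ev_of x (event t') && (event t' == cur t x).
Proof.
elim: t => // t IH; rewrite curS; case: ifP => [H _|_ /IH[t' tt' H]].
  by exists t => //; rewrite H /=.
by exists t' => //; exact: leqW.
Qed.

Lemma cur_const t0 t x : t0 < t -> is_ev_of x (event t0) ->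
  (forall t', t0 < t' < t -> ~~ is_ev_of x (event t')) -> cur t x = event t0.
Proof.
elim: t => // t IH; rewrite ltnS leq_eqVlt curS => /orP[/eqP <- -> //|lt_t] H0 Hn.
rewrite (negbTE (Hn t _)) ?lt_t ?ltnSn //; apply: IH => // t' /andP[a b].
by apply: Hn; rewrite a leqW.
Qed.

Lemma cur0 t x : (forall t', t' < t -> ~~ is_ev_of x (event t')) -> cur t x = 0.
Proof.
elim: t => // t IH H; rewrite curS (negbTE (H t _)) //.
by apply: IH => t' tt'; apply: H; exact: leqW.
Qed.

Definition child h r := mkst (st_R h).-1 (st_c h) (pair r (st_l h)).+1.

Lemma enters_of t x h q : enters t x h q -> is_ev_of x (event t).
Proof. by move=> E; rewrite /is_ev_of E mkevK eqxx. Qed.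

Lemma of_ent t x : is_ev_of x (event t) -> exists h q, enters t x h q.
Proof.
case/andP => /ev_ent E /eqP <-; exists (ev_st (event t)), (num_enters t (ev_st (event t))).
by rewrite /enters E !mkevK.
Qed.

Definition hits s r x h q :=
  [/\ 2 ^ (st_R h + st_c h) <= r.+1 < 2 ^ (st_R h + st_c h).+1,
      run eU s [:: r; lnode x] = (rnode h q).+1 &
      run eU' s [:: r; rnode h q] = (lnode x).+1].

Lemma respP s r x h q : reflect (hits s r x h q) (resp eU eU' (mkev x h q) s r).
Proof.
rewrite /resp !mkevK; apply: (iffP and4P) => [[h1 h2 /eqP h3 /eqP h4]|[/andP[h1 h2] h3 h4]].
  by split=> //; rewrite h1 h2.
by split=> //; apply/eqP.
Qed.

Lemma ev_cur t x h q : enters t x h q ->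
  (cur t x = 0 /\ h = root_st x) \/
  (exists t0 h0 q0 r s, [/\ t0 < t, enters t0 x h0 q0, cur t x = mkev x h0 q0 &
     [/\ 0 < st_R h0, hits s r x h0 q0 & h = child h0 r]]).
Proof.
move=> E; move: (E); rewrite /enters evE /= -(enters_num E).1.
case: ifP => // Hf /(congr1 ev_st); rewrite !mkevK /new_st /fires in Hf *.
have [e0 <-|e0 Eh] := eqVneq (cur t x) 0; first by left; rewrite e0 (enters_num E).1.
right; have [t0 tt0 /andP[/of_ent[h0 [q0 E0]] /eqP Ec]] := cur_of e0.
move: Hf Eh; rewrite (negbTE e0) /= -Ec E0 /next_st !mkevK => /andP[R0 /respP Hr] Eh.
by exists t0, h0, q0, (p1 (p2 t)), (p2 (p2 t)).
Qed.

Lemma cur_R t1 t x h1 q1 : enters t1 x h1 q1 -> t1 < t ->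
  cur t x != 0 /\ st_R (ev_st (cur t x)) <= st_R h1.
Proof.
move=> E1; elim: t => // t IH; rewrite ltnS leq_eqVlt curS => /orP[/eqP <-|lt_t].
  by rewrite (enters_of E1) E1 mkevK.
have [c0 cR] := IH lt_t; case: ifP => // /of_ent[h [q E]].
rewrite E mkevK; split=> //.
case: (ev_cur E) => [[c0' _]|[t0 [h0 [q0 [r [s [_ _ Ec [R0 _ ->]]]]]]]].
  by rewrite c0' in c0.
by rewrite Ec mkevK in cR; rewrite /child mkstK; lia.
Qed.

Lemma enters_R_lt t1 t2 x h1 h2 q1 q2 :
  enters t1 x h1 q1 -> enters t2 x h2 q2 -> t1 < t2 -> st_R h2 < st_R h1.
Proof.
move=> E1 E2 lt_t; have [c0 cR] := cur_R E1 lt_t.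
case: (ev_cur E2) => [[c0' _]|[t0 [h0 [q0 [r [s [_ _ Ec [R0 _ ->]]]]]]]].
  by rewrite c0' in c0.
by rewrite Ec mkevK in cR; rewrite /child mkstK; lia.
Qed.

(** Each later event of [x] costs it a round, so [x] and [R] determine the edge. This is why a unary
    code of [R] suffices to name the right vertex given [x]. *)
Lemma enters_R_inj t1 t2 x h1 h2 q1 q2 :
  enters t1 x h1 q1 -> enters t2 x h2 q2 -> st_R h1 = st_R h2 -> h1 = h2 /\ q1 = q2.
Proof.
move=> E1 E2 ER; have E : t1 = t2.
  case: (ltngtP t1 t2) => // H.
    by have := enters_R_lt E1 E2 H; rewrite ER ltnn.
  by have := enters_R_lt E2 E1 H; rewrite ER ltnn.
move: E2; rewrite -E /enters E1 => F.
have := congr1 ev_st F; have := congr1 ev_q F.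
by rewrite !mkevK => -> ->.
Qed.

(** The stage [pair x (pair r s)] tests [r] with sufficient fuel [s] and, being above [t0], fires
    unless [x] has moved in between. The answer [r'] that moves [x] can thus differ from [r]. *)
Lemma enters_child t0 x h q r : enters t0 x h q -> 0 < st_R h ->
  eventually (fun s => hits s r x h q) ->
  exists t r' s q', [/\ t0 < t, hits s r' x h q & enters t x (child h r') q'].
Proof.
move=> E0 R0 /(eventually_geq t0.+1)[s t0s Hs].
have Hex : exists t, (t0 < t) && is_ev_of x (event t).
  pose t := pair x (pair r s).
  have t0t : t0 < t.
    by apply: (leq_trans t0s); apply: (leq_trans (leq_pair2 r s)); exact: leq_pair2.
  case: (classic (exists t', (t0 < t' < t) && is_ev_of x (event t')))
    => [[t' /andP[/andP[H _] H']]|Hn].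
    by exists t'; rewrite H.
  exists t; rewrite t0t /=.
  have Ec : cur t x = event t0.
    apply: cur_const => //; first exact: enters_of E0.
    by move=> t' H; apply/negP => H'; apply: Hn; exists t'; rewrite H.
  have [Ex Er Es] : [/\ p1 t = x, p1 (p2 t) = r & p2 (p2 t) = s] by rewrite /t !pairE.
  rewrite evE /= Ex Ec E0 /fires /= !mkevK R0 Er Es.
  by move/respP: Hs => ->; rewrite /is_ev_of mkevK /= eqxx.
case: (ex_minnP Hex) => t /andP[t0t /of_ent[h' [q' E]]] min_t.
have Ec : cur t x = event t0.
  apply: cur_const => //; first exact: enters_of E0.
  move=> t' /andP[a b]; apply/negP => H; have := min_t t'.
  by rewrite a H leqNgt b => /(_ isT).
case: (ev_cur E) => [[c0 _]|[t1 [h1 [q1 [r' [s' [_ _ Ec' [_ Hh Eh]]]]]]]].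
  by rewrite c0 E0 in Ec.
move: Ec; rewrite Ec' E0 => F.
have Eh1 := congr1 ev_st F; have Eq1 := congr1 ev_q F; rewrite !mkevK in Eh1 Eq1.
by subst h1 q1 h'; exists t, r', s', q'.
Qed.

Lemma enters_root x : exists t q, x <= t /\ enters t x (root_st x) q.
Proof.
have Hex : exists t, is_ev_of x (event t).
  pose t := pair x 0.
  have [c0|/cur_of[t' _ /andP[H _]]] := eqVneq (cur t x) 0; last by exists t'.
  have Ex : p1 t = x by rewrite /t pairK1.
  by exists t; rewrite evE /= Ex c0 /fires /is_ev_of mkevK /= eqxx.
case: (ex_minnP Hex) => t /of_ent[h [q E]] min_t.
have c0 : cur t x = 0.
  by apply: cur0 => t' tt'; apply/negP => /min_t; rewrite leqNgt tt'.
exists t, q; split; first by rewrite (enters_num E).1 p1_leq.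
case: (ev_cur E) => [[_ <-] //|[t1 [h1 [q1 [r' [s' [_ _ Ec' _]]]]]]].
by rewrite c0 in Ec'.
Qed.

End Events.

(** * The prefix-free function that makes the edges cheap *)

(** Definedness need not be decidable, so the function is extracted classically; its computability
    comes from [search_prog]. *)
Definition fun_of (G : bstr -> bstr -> bstr -> Prop) : pfun2 := fun p x =>
  match excluded_middle_informative (exists y, G p x y) with
  | left H => Some (proj1_sig (constructive_indefinite_description _ H))
  | right _ => None
  end.

Lemma fun_ofP (G : bstr -> bstr -> bstr -> Prop) p x y :
  (forall y1 y2, G p x y1 -> G p x y2 -> y1 = y2) -> fun_of G p x = Some y <-> G p x y.
Proof.
move=> Gf; rewrite /fun_of; case: excluded_middle_informative => [H|H].
  have := proj2_sig (constructive_indefinite_description _ H); set y' := proj1_sig _ => Gy'.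
  by split=> [[<-]|Gy] //; rewrite (Gf _ _ Gy Gy').
by split=> // Gy; case: H; exists y.
Qed.

Lemma pair_inj a b a' b' : pair a b = pair a' b' -> a = a' /\ b = b'.
Proof.
by move=> E; have := congr1 p1 E; have := congr1 p2 E; rewrite !pairE.
Qed.

Lemma rnode_inj h q h' q' : rnode h q = rnode h' q' ->
  h = h' /\ q %/ 2 ^ st_R h = q' %/ 2 ^ st_R h.
Proof.
rewrite /rnode => E.
have /pair_inj[-> ->] : pair h (q %/ 2 ^ st_R h) = pair h' (q' %/ 2 ^ st_R h') by lia.
by [].
Qed.

Lemma lnode_inj : injective lnode.
Proof. by rewrite /lnode => x y; lia. Qed.

Lemma lnode_rnode x h q : lnode x <> rnode h q.
Proof. by rewrite /lnode /rnode; lia. Qed.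

Section Requests.
Variables (eU eU' : prog).
Local Notation enters := (enters eU eU').
Local Notation lookup := (lookup eU eU').

Lemma lookupP (t p z a : nat) : lookup t p z = a.+1 -> exists x h q, enters t x h q /\
  ([/\ z = lnode x, p = 3 * 2 ^ st_R h - 1 & a = rnode h q] \/
   [/\ z = rnode h q, p = 2 ^ st_R h - 1 + q %% 2 ^ st_R h & a = lnode x]).
Proof.
rewrite /lookup; have [//|/ev_ent E] := eqVneq (event eU eU' t) 0.
move=> H; do 3!eexists; split; first exact: E.
move: H; rewrite E !mkevK; case: ifP => [/andP[/eqP -> /eqP ->] [<-]|_]; first by left.
by case: ifP => [/andP[/eqP -> /eqP ->] [<-]|//]; right.
Qed.

Lemma lookup_l t x h q : enters t x h q ->
  lookup t (3 * 2 ^ st_R h - 1) (lnode x) = (rnode h q).+1.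
Proof. by rewrite /lookup => ->; rewrite !mkevK !eqxx. Qed.

Lemma lookup_r t x h q : enters t x h q ->
  lookup t (2 ^ st_R h - 1 + q %% 2 ^ st_R h) (rnode h q) = (lnode x).+1.
Proof.
rewrite /lookup => ->; rewrite !mkevK !eqxx /=; case: eqP => // H.
by case: (@lnode_rnode x h q).
Qed.

(** At a left vertex the program fixes [R], hence the edge by [enters_R_inj]. At a right vertex, [z]
    fixes the status and the block, and [p] the rank within the block. *)
Lemma lookup_fun (t t' p z a a' : nat) :
  lookup t p z = a.+1 -> lookup t' p z = a'.+1 -> a = a'.
Proof.
move=> /lookupP[x [h [q [E H]]]] /lookupP[x' [h' [q' [E' H']]]].
case: H H' => [[-> -> ->] | [-> -> ->]] [[Ez Ep ->] | [Ez Ep ->]].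
- have Ex := lnode_inj Ez; subst x'.
  have ER : st_R h = st_R h'.
    apply: (@expnI 2) => //; have := expn_gt0 2 (st_R h).
    by have := expn_gt0 2 (st_R h'); lia.
  by have [-> ->] := enters_R_inj E E' ER.
- by case: (lnode_rnode Ez).
- by case: (lnode_rnode (esym Ez)).
- have [Eh Eq] := rnode_inj Ez; subst h'.
  have Em : q %% 2 ^ st_R h = q' %% 2 ^ st_R h by lia.
  have Eqq : q = q' by rewrite (divn_eq q (2 ^ st_R h)) Eq Em -divn_eq.
  by subst q'; have [_ ->] := enters_inj E E'.
Qed.

Definition request p z y :=
  exists2 t, lookup t (code p) (code z) = (code y).+1 &
    forall m, m < t -> lookup m (code p) (code z) = 0.

Lemma request_fun p z y1 y2 : request p z y1 -> request p z y2 -> y1 = y2.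
Proof. by move=> [t Ht _] [t' Ht' _]; apply/code_inj/(lookup_fun Ht Ht'). Qed.

Lemma requestI t p z y : lookup t (code p) (code z) = (code y).+1 -> request p z y.
Proof.
move=> Ht; have Hex : exists t, lookup t (code p) (code z) != 0 by exists t; rewrite Ht.
case: (ex_minnP Hex) => t' Ht' min_t; exists t'.
  case El : (lookup t' _ _) Ht' => [//|a] _.
  by rewrite (lookup_fun El Ht).
by move=> m; apply: contraTeq => /min_t; rewrite -leqNgt.
Qed.

Definition reqf := fun_of request.

Lemma reqfP p z y : reqf p z = Some y <-> request p z y.
Proof. by apply: fun_ofP => y1 y2; exact: request_fun. Qed.

Lemma reqf_computable : computable2 reqf.
Proof.
have [e He] := search_prog (vcomp_lookup eU eU').
by exists e => p x y; rewrite reqfP He.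
Qed.

Lemma request_size_r p h q : (exists y, request p (decode (rnode h q)) y) -> size p = st_R h.
Proof.
move=> [y [t]]; rewrite decodeK => /lookupP[x [h' [q' [_ [[Ez _ _]|[Ez Ep _]]]]]] _.
  by case: (lnode_rnode (esym Ez)).
have [Eh _] := rnode_inj Ez; subst h'.
apply/eqP; rewrite size_code Ep expnS.
by have := ltn_pmod q' (expn_gt0 2 (st_R h)); have := expn_gt0 2 (st_R h); lia.
Qed.

(** At a left vertex all programs are unary codes, at a right vertex all have the same length, and
    no vertex is of both kinds. *)
Lemma reqf_prefix_free : prefix_free reqf.
Proof.
have dom p z : reqf p z <> None -> exists y, request p z y.
  by case E : (reqf p z) => [y|//] _; exists y; apply/reqfP.
move=> z p q q0 /dom H1 /dom H2; case: (H1) => y1 [t1 /lookupP[x1 [h1 [n1 [_ C1]]]] _].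
case: C1 => [[Ez1 Ep1 _]|[Ez _ _]].
  case: H2 => y2 [t2 /lookupP[x2 [h2 [n2 [_ [[_ Ep2 _]|[Ez2 _ _]]]]]] _]; last first.
    by rewrite Ez1 in Ez2; case: (lnode_rnode Ez2).
  rewrite -code_unary in Ep1; rewrite -code_unary in Ep2.
  rewrite (code_inj Ep1) in Ep2.
  by have /unary_prefix := esym (code_inj Ep2); move/eqP: q0.
have Ez' : z = decode (rnode h1 n1) by rewrite -Ez codeK.
rewrite Ez' in H1 H2; move: (request_size_r H2); rewrite size_cat (request_size_r H1).
by case: q q0 {H2} => //= b q _; lia.
Qed.

Definition Lnode x := decode (lnode x).
Definition Rnode h q := decode (rnode h q).

Lemma reqf_l t x h q : enters t x h q -> K_le reqf (Rnode h q) (Lnode x) (st_R h).+1.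
Proof.
move=> E; exists (unary (st_R h)); rewrite size_unary; split=> //.
by apply/reqfP/(@requestI t); rewrite code_unary !decodeK; exact: lookup_l.
Qed.

(** The program has only [st_R h] bits; the bound is relaxed to that of [reqf_l], as [E1_le] needs a
    common one. *)
Lemma reqf_r t x h q : enters t x h q -> K_le reqf (Lnode x) (Rnode h q) (st_R h).+1.
Proof.
move=> E; set p := decode (2 ^ st_R h - 1 + q %% 2 ^ st_R h).
have Hp : request p (Rnode h q) (Lnode x).
  by apply: (@requestI t); rewrite !decodeK; exact: lookup_r.
exists p; split; last exact/reqfP.
by rewrite (@request_size_r p h q) //; exists (Lnode x).
Qed.

(** * Answers of the pair and histories *)

Variables (U U' : pfun2).
Hypothesis HU : forall p x y, U p x = Some y <-> eval eU [:: code p; code x] (code y).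
Hypothesis HU' : forall p x y, U' p x = Some y <-> eval eU' [:: code p; code x] (code y).

Definition answer p x h q :=
  [/\ size p = st_R h + st_c h, U p (Lnode x) = Some (Rnode h q)
    & U' p (Rnode h q) = Some (Lnode x)].

Lemma hits_answer s r x h q : hits eU eU' s r x h q -> answer (decode r) x h q.
Proof.
move=> [Hr /run_sound H1 /run_sound H2]; split.
- by apply/eqP; rewrite size_code decodeK.
- by apply/HU; rewrite !decodeK.
- by apply/HU'; rewrite !decodeK.
Qed.

Lemma answer_hits p x h q : answer p x h q ->
  eventually (fun s => hits eU eU' s (code p) x h q).
Proof.
move=> [/eqP Hs /HU/run_complete H1 /HU'/run_complete H2].
apply: eventually_imp (eventually_and H1 H2) => s; rewrite !decodeK => -[h1 h2].
by split=> //; rewrite -size_code.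
Qed.

Fixpoint lcode (l : seq bstr) :=
  if l is p :: l' then (pair (code p) (lcode l')).+1 else 0.

Lemma mkst_inj R c l R' c' l' : mkst R c l = mkst R' c' l' -> [/\ R = R', c = c' & l = l'].
Proof. by move=> /pair_inj[-> /pair_inj[-> ->]]. Qed.

Definition stat R c l := mkst R c (lcode l).

Lemma child_stat R c l r : child (stat R.+1 c l) r = stat R c (decode r :: l).
Proof. by rewrite /child !mkstK /stat /= decodeK. Qed.

(** Each entry of the history answered an edge of the same [x] to a status with more rounds, hence
    to another right vertex. Prefix stability will therefore forbid its prefixes as answers. *)
Lemma enters_history t x R c l q : enters t x (stat R c l) q ->
  forall p, p \in l -> R + c <= size p /\
    exists h' q', R < st_R h' /\ U p (Lnode x) = Some (Rnode h' q').
Proof.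
have [n] := ubnP t; elim: n t R l q => // n IH t R l q tn E p pl.
case: (ev_cur E) => [[_ Eh]|[t0 [h0 [q0 [r [s [t0t E0 _ [R0 Hh Eh]]]]]]]].
  by have [_ _ El] := mkst_inj Eh; case: l pl El {E Eh}.
have [ER Ec El] := mkst_inj Eh.
case: l pl El {Eh E} => [//|p0 l] pl [] /pair_inj[Ep El].
have Est : h0 = stat R.+1 c l.
  (* [pair] is not surjective: components determine a status only because it was built by [mkst]. *)
  have [R' [c' [l' Eh0]]] : exists R' c' l', h0 = mkst R' c' l'.
    by case: (ev_cur E0) => [[_ ->]|[? [? [? [? [? [_ _ _ [_ _ ->]]]]]]]];
      rewrite /root_st /child; do 3!eexists.
  move: ER Ec El R0; rewrite Eh0 !mkstK /stat => -> -> -> R0.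
  by rewrite prednK.
move: pl; rewrite in_cons => /orP[/eqP ->|pl].
  have [Hs H1 _] := hits_answer Hh.
  rewrite -[p0]codeK Ep Hs Est !mkstK; split; first by lia.
  by exists h0, q0; split=> //; rewrite Est mkstK.
rewrite Est in E0; have [|h1 [h' [q' [h2 h3]]]] := IH _ _ _ _ _ E0 p pl; first by lia.
by split; [lia | exists h', q'; split; [lia|]].
Qed.

End Requests.

(** * The combinatorial argument *)

Definition strings n : seq bstr := [seq tval w | w <- enum {:n.-tuple bool}].

Lemma size_strings n : size (strings n) = 2 ^ n.
Proof. by rewrite size_map -cardT card_tuple card_bool. Qed.

Lemma mem_strings n s : size s = n -> s \in strings n.
Proof.
move=> /eqP sn; apply/mapP; exists (Tuple sn) => //.
by rewrite mem_enum.
Qed.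

Definition prefixes m (l : seq bstr) : seq bstr := undup [seq take m p | p <- l].

Lemma prefixes_cons m p l :
  size (prefixes m (p :: l)) = (take m p \notin prefixes m l) + size (prefixes m l).
Proof. by rewrite /prefixes /= mem_undup; case: ifP. Qed.

Lemma leq_prefixes m j (l s : seq bstr) : j <= m -> uniq s ->
  {in s, forall p, size p = m /\ take j p \in prefixes j l} ->
  size s <= size (prefixes j l) * 2 ^ (m - j).
Proof.
move=> jm us Hs; rewrite -size_strings -(size_allpairs (fun u w => u ++ w)).
apply: uniq_leq_size => // p /Hs[sp pj]; apply/allpairsP.
exists (take j p, drop j p); rewrite cat_take_drop; split=> //.
by apply: mem_strings; rewrite size_drop sp.
Qed.

Lemma prefixes_sub m j l : j <= m -> {in l, forall p, m <= size p} ->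
  {in prefixes m l, forall p, size p = m /\ take j p \in prefixes j l}.
Proof.
move=> jm Hl p; rewrite mem_undup => /mapP[p' p'l ->]; split.
  by rewrite size_takel // Hl.
by rewrite take_takel // mem_undup map_f.
Qed.

(** * The game against a pair that answers every edge *)

Section Game.
Variables (eU eU' : prog) (U U' : pfun2).
Hypothesis HU : forall p x y, U p x = Some y <-> eval eU [:: code p; code x] (code y).
Hypothesis HU' : forall p x y, U' p x = Some y <-> eval eU' [:: code p; code x] (code y).
Hypotheses (stabU : prefix_stable U).
Local Notation enters := (enters eU eU').
Local Notation answer := (answer U U').
Local Notation infinite_st := (infinite_st eU eU').

Variable c : nat.
Hypothesis answered : forall t x h q, enters t x h q -> st_c h = c ->
  exists p, answer p x h q.

Lemma infinite_root N : infinite_st (stat N c [::]).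
Proof.
(* The component [B] does not affect the root status and only forces a late stage. *)
move=> B; have [t [q [xt E]]] := enters_root eU eU' (pair c (pair N B)).
exists t, (pair c (pair N B)), q; split.
  by apply: (leq_trans _ xt); apply: (leq_trans (leq_pair2 N B)); exact: leq_pair2.
by move: E; rewrite /root_st !pairE.
Qed.

Definition advances R l q p := exists t x t' q',
  [/\ enters t x (stat R.+1 c l) q, answer p x (stat R.+1 c l) q, t < t'
    & enters t' x (stat R c (p :: l)) q'].

Lemma advances_ex R l q : infinite_st (stat R.+1 c l) -> exists p, advances R l q p.
Proof.
move=> /infinite_st_all/(_ q)[t [x E]].
have [p Hp] : exists p, answer p x (stat R.+1 c l) q by apply: (answered E); rewrite mkstK.
have [|t' [r [s [q' [tt' Hh E']]]]] := enters_child E _ (answer_hits HU HU' Hp).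
  by rewrite mkstK.
exists (decode r), t, x, t', q'; split=> //; first exact: hits_answer Hh.
by rewrite -child_stat.
Qed.

Lemma advances_size R l q p : advances R l q p -> size p = R.+1 + c.
Proof. by move=> [t [x [t' [q' [_ [-> _ _] _ _]]]]]; rewrite !mkstK. Qed.

Lemma decode_inj : injective decode.
Proof. exact: can_inj decodeK. Qed.

(** A block has a single right vertex, from which [U'] on [p] recovers [x], and [x] enters a status
    only once. *)
Lemma advances_inj R l q1 q2 p : advances R l q1 p -> advances R l q2 p ->
  q1 %/ 2 ^ R.+1 = q2 %/ 2 ^ R.+1 -> q1 = q2.
Proof.
move=> [t1 [x1 [_ [_ [E1 [_ _ A1] _ _]]]]] [t2 [x2 [_ [_ [E2 [_ _ A2] _ _]]]]] Eq.
have Er : Rnode (stat R.+1 c l) q1 = Rnode (stat R.+1 c l) q2.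
  by rewrite /Rnode /rnode mkstK Eq.
move: A2; rewrite -Er A1 => -[] /decode_inj/lnode_inj Ex; subst x2.
by have [_ ->] := enters_R_inj E1 E2 (erefl _).
Qed.

Lemma advances_history R l q p : advances R l q p -> {in l, forall p', R.+1 + c <= size p'}.
Proof.
move=> [t [x [_ [_ [E _ _ _]]]]] p' p'l.
by have [] := enters_history HU HU' E p'l.
Qed.

(** If [p] were a prefix of an old answer [p'], then [U] on [p'] and [x] would give both the present
    right vertex and an earlier one. *)
Lemma advances_fresh R l q p : advances R l q p -> p \notin prefixes (R.+1 + c) l.
Proof.
move=> [t [x [_ [_ [E [Hs A1 _] _ _]]]]].
rewrite mem_undup; apply/mapP => -[p' p'l Ep].
have [_ [h' [q' [hR A2]]]] := enters_history HU HU' E p'l.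
have := stabU A1 (drop (R.+1 + c) p'); rewrite {1}Ep cat_take_drop A2.
by case=> /decode_inj/rnode_inj[Eh _]; rewrite Eh mkstK ltnn in hR.
Qed.

(** Pigeonhole: otherwise one bound [B] on the stages serves all the finitely many good answers, but
    a vertex of rank at least [B] moves on after stage [B], since a rank never exceeds its stage. *)
Lemma infinite_child R l (Good : bstr -> Prop) :
  (forall i, exists q p, [/\ i <= q, advances R l q p & Good p]) ->
  exists p, [/\ Good p, size p = R.+1 + c & infinite_st (stat R c (p :: l))].
Proof.
move=> H; apply: NNPP => Hn.
have [B HB] : exists B, forall p, p \in strings (R.+1 + c) -> Good p ->
    forall t x q, B <= t -> ~ enters t x (stat R c (p :: l)) q.
  have : forall p, p \in strings (R.+1 + c) -> size p = R.+1 + c.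
    by move=> p /mapP[w _ ->]; rewrite size_tuple.
  elim: (strings _) => [|p s IH] Hs; first by exists 0.
  have [|B HB] := IH; first by move=> p' p's; apply: Hs; rewrite in_cons p's orbT.
  have [B' HB'] : exists B', Good p ->
      forall t x q, B' <= t -> ~ enters t x (stat R c (p :: l)) q.
    case: (classic (Good p)) => Gp; last by exists 0.
    apply: NNPP => Hn'; apply: Hn; exists p; split=> //.
      by apply: Hs; rewrite mem_head.
    move=> B'; apply: NNPP => Hn''; apply: Hn'; exists B' => _ t x q B't E.
    by apply: Hn''; exists t, x, q.
  exists (maxn B B') => p'; rewrite in_cons => /orP[/eqP ->|p's] Gp' t x q;
    rewrite geq_max => /andP[Bt B't]; [exact: HB' | exact: HB].
have [q [p [Bq M Gp]]] := H B; have sp := advances_size M.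
move: M => [t [x [t' [q' [E _ tt' E']]]]].
apply: (HB p (mem_strings sp) Gp t' x q') E'.
by rewrite (leq_trans Bq) // (leq_trans _ (ltnW tt')) // (enters_num E).2 num_enters_leq.
Qed.

Lemma infinite_next R l : infinite_st (stat R.+1 c l) ->
  exists p, [/\ size p = R.+1 + c & infinite_st (stat R c (p :: l))].
Proof.
move=> Hinf; have [|p [_ sp Hp]] := @infinite_child R l (fun=> True).
  by move=> i; have [p Hp] := advances_ex i Hinf; exists i, p.
by exists p.
Qed.

(* Otherwise the answers of each block, together with the elements of
   [prefixes (R.+1 + c) l], would be too many extensions of [prefixes j l]. *)
Lemma infinite_spread R l j : infinite_st (stat R.+1 c l) -> j <= R.+1 + c ->
  size (prefixes j l) * 2 ^ (R.+1 + c - j) < 2 ^ R.+1 + size (prefixes (R.+1 + c) l) ->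
  exists p, [/\ take j p \notin prefixes j l, size p = R.+1 + c
              & infinite_st (stat R c (p :: l))].
Proof.
move=> Hinf jm Hlt; apply: infinite_child => i.
apply: NNPP => Hn; move: Hlt; apply/negP; rewrite -leqNgt.
pose f q := proj1_sig (constructive_indefinite_description _ (advances_ex q Hinf)).
have Hf q : advances R l q (f q).
  exact: proj2_sig (constructive_indefinite_description _ (advances_ex q Hinf)).
(* The ranks in block number [i]; all of them are at least [i]. *)
pose Q := iota (i * 2 ^ R.+1) (2 ^ R.+1).
have Qdiv q : q \in Q -> q %/ 2 ^ R.+1 = i.
  rewrite mem_iota => /andP[h1 h2]; apply/eqP.
  by rewrite eqn_leq leq_divRL ?expn_gt0 // h1 -ltnS ltn_divLR ?expn_gt0 // mulSn addnC h2.
have uQ : uniq (map f Q).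
  rewrite map_inj_in_uniq ?iota_uniq // => q1 q2 /Qdiv E1 /Qdiv E2 Ef.
  have M1 := Hf q1; rewrite Ef in M1.
  by apply: (advances_inj M1 (Hf q2)); rewrite E1 E2.
have -> : 2 ^ R.+1 + size (prefixes (R.+1 + c) l) = size (map f Q ++ prefixes (R.+1 + c) l).
  by rewrite size_cat size_map size_iota.
apply: leq_prefixes => //.
  rewrite cat_uniq uQ undup_uniq andbT /=; apply/hasPn => p pl.
  by apply/mapP => -[q _ Ep]; have := advances_fresh (Hf q); rewrite -Ep pl.
move=> p; rewrite mem_cat => /orP[/mapP[q qQ ->]|].
  split; first exact: advances_size (Hf q).
  apply: contraT => Hnot; case: Hn; exists q, (f q); split=> //.
  rewrite -(Qdiv q qQ); exact: leq_div.
by apply: prefixes_sub => //; exact: advances_history (Hf 0).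
Qed.

(** Lowering the level by one does not decrease the density of the prefixes. *)
Lemma prefixes_half R l : {in l, forall p, R.+1 + c <= size p} ->
  size (prefixes (R.+1 + c) l) <= 2 * size (prefixes (R + c) l).
Proof.
move=> Hl; have Hle : R + c <= R.+1 + c by rewrite leq_add2r.
have := leq_prefixes Hle (undup_uniq _) (prefixes_sub Hle Hl).
by rewrite addSn subSnn expn1 mulnC.
Qed.

(** Invariant after [i] rounds: at the moving level [R + c] the density stays at least [a / 2 ^ c];
    at the target level [T + c] it is at least [a.+1 / 2 ^ c], or else the prefixes have grown in
    every round. *)
Lemma phase T a i l0 : a < 2 ^ c -> i <= 2 ^ (T + c) ->
  infinite_st (stat (T + 2 ^ (T + c)) c l0) ->
  a * 2 ^ (T + 2 ^ (T + c)) <= size (prefixes (T + 2 ^ (T + c) + c) l0) ->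
  exists R l, [/\ R + i = T + 2 ^ (T + c), infinite_st (stat R c l),
    a * 2 ^ R <= size (prefixes (R + c) l) &
    a.+1 * 2 ^ T <= size (prefixes (T + c) l) \/ i <= size (prefixes (T + c) l)].
Proof.
move=> a_lt; elim: i => [|i IH] i_le Hinf0 H0.
  by exists (T + 2 ^ (T + c)), l0; split=> //; [rewrite addn0 | right].
have [[|R] [l [ER Hinf HS Hor]]] := IH (ltnW i_le) Hinf0 H0; first by lia.
have TR : T <= R by lia.
suff [p [sp Hp Hor']] : exists p, [/\ size p = R.+1 + c, infinite_st (stat R c (p :: l))
    & a.+1 * 2 ^ T <= size (prefixes (T + c) (p :: l)) \/
      i.+1 <= size (prefixes (T + c) (p :: l))].
  exists R, (p :: l); split=> //; first by lia.
  have [p' M] := advances_ex 0 Hinf.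
  have Hl : {in p :: l, forall p', R.+1 + c <= size p'}.
    by move=> p1; rewrite in_cons => /orP[/eqP -> |/(advances_history M)//]; rewrite sp.
  have := prefixes_half Hl; rewrite prefixes_cons.
  by move: HS; rewrite expnS; lia.
have [big|small] := leqP (a.+1 * 2 ^ T) (size (prefixes (T + c) l)).
  have [p [sp Hp]] := infinite_next Hinf; exists p; split=> //; left.
  by rewrite prefixes_cons (leq_trans big) // leq_addl.
have [||p [pn sp Hp]] := @infinite_spread R l (T + c) Hinf.
- by rewrite leq_add2r leqW.
(* While the target is missed, the left side is below [a.+1 * 2 ^ R.+1], and [HS] bounds the part
   [a * 2 ^ R.+1] by the prefixes at level [R.+1 + c]. *)
- rewrite subnDr; apply: (@leq_trans (a.+1 * 2 ^ R.+1)); last by rewrite mulSn leq_add2l.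
  have -> : 2 ^ R.+1 = 2 ^ T * 2 ^ (R.+1 - T) by rewrite -expnD subnKC // leqW.
  by rewrite mulnA ltn_pmul2r // expn_gt0.
exists p; split=> //; right; rewrite prefixes_cons pn add1n ltnS.
by case: Hor => // big; move: small; rewrite ltnNge big.
Qed.

(** The rounds needed when [n] phases are still to come; the base value keeps one round for the
    final contradiction. *)
Fixpoint rounds n := if n is m.+1 then rounds m + 2 ^ (rounds m + c) else 1.

(** Each phase raises [a] by one. At [a = 2 ^ c] the prefixes of length [1 + c] are all the strings
    of that length, and the last round still demands a fresh one. *)
Lemma game_lost : False.
Proof.
have H a : a <= 2 ^ c -> exists l, infinite_st (stat (rounds (2 ^ c - a)) c l) /\
    a * 2 ^ rounds (2 ^ c - a) <= size (prefixes (rounds (2 ^ c - a) + c) l).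
  elim: a => [|a IH] a_le; first by exists [::]; split=> //; exact: infinite_root.
  have [l0 []] := IH (ltnW a_le); rewrite -subnSK //=; set T := rounds _ => Hinf HS.
  have [R [l [ER Hl _ Hor]]] := phase a_le (leqnn _) Hinf HS.
  have {ER}ER : R = T by lia.
  subst R; exists l; split=> //; case: Hor => // big.
  (* Growth in all [2 ^ (T + c)] rounds exhausts the level, which also gives the density. *)
  by apply: leq_trans big; rewrite expnD mulnC leq_mul2l a_le orbT.
have [l []] := H _ (leqnn _); rewrite subnn /= => Hinf HS.
have [p M] := advances_ex 0 Hinf.
have : size (p :: prefixes (1 + c) l) <= size (strings (1 + c)).
  apply: uniq_leq_size; first by rewrite /= (advances_fresh M) undup_uniq.
  move=> p'; rewrite in_cons => /orP[/eqP ->|]; first by apply/mem_strings/(advances_size M).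
  by move/(prefixes_sub (leqnn _) (advances_history M)) => [/mem_strings].
by rewrite size_strings /= ltnNge add1n expnS mulnC HS.
Qed.

End Game.

(* D = E_{U,U'} for an optimal pair (U,U'); KP = K_V for an optimal
   prefix-free V.  There is no c with D(x,y) <= E_1(x,y) + c for all x, y. *)
Theorem theorem4 :
  forall (U U' V : pfun2),
    optimal_pair U U' -> optimal_prefix_free V ->
    ~ (exists c : nat, forall (x y : bstr) (n : nat),
          E1_le V x y n -> E_le U U' x y (n + c)).
Proof.
move=> U U' V [[eU HU] stabU [eU' HU'] stabU' _] [_ _ optV] [c0 Hc0].
have [cW HW] := optV _ (reqf_computable eU eU') (@reqf_prefix_free eU eU').
(* An edge costs [R + 1] under [reqf], [cW] more under [V] and [c0] more for the pair. *)
apply: (@game_lost eU eU' U U' HU HU' stabU (cW + c0).+1) => t x h q E Ec.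
have [p [sp [A1 A2]]] := Hc0 _ _ _ (conj (HW _ _ _ (reqf_r E)) (HW _ _ _ (reqf_l E))).
(* Prefix stability allows padding to the exact length that [answer] requires. *)
exists (p ++ nseq (st_R h + st_c h - size p) false).
split; [rewrite size_cat size_nseq Ec; lia | exact: stabU | exact: stabU'].
Qed.
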